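(* Let $(A,b)\in\mathbb{R}^{m\times n}\times\mathbb{R}^m$ and let $\bar x$ be an M-stationary point of $\mathrm{SR}(A,b)$. Then $\bar x$ is strongly stable if and only if it is nondegenerate.
   Context: Fix integers $m,n$ and $s\in\{0,1,\ldots,n-1\}$ with $s\le m$ (standing assumption). For $x\in\mathbb{R}^n$, $\|x\|_0$ is the number of non-zero entries of $x$, and $\mathbb{R}^{n,s}=\{x\in\mathbb{R}^n : \|x\|_0\le s\}$. For $(A,b)\in\mathbb{R}^{m\times n}\times\mathbb{R}^m$, the sparse recovery problem $\mathrm{SR}(A,b)$ is to minimize $f(x)=\frac12\|Ax-b\|_2^2$ subject to $x\in\mathbb{R}^{n,s}$. For $x\in\mathbb{R}^{n,s}$ put $I_0(x)=\{i : x_i=0\}$ and $I_1(x)=\{j : x_j\neq 0\}$. For an index set $I\subset\{1,\ldots,n\}$, $A_I$ is the submatrix of $A$ formed by the columns with index in $I$, $A_I^T$ is its transpose, and $x_I$ is the subvector of $x$ with entries indexed by $I$ (terms with empty index set are zero, conditions on an empty index set are vacuous). A point $\bar x\in\mathbb{R}^{n,s}$ is called M-stationary for $\mathrm{SR}(A,b)$ if $A_{I_1(\bar x)}^TA_{I_1(\bar x)}\bar x_{I_1(\bar x)}-A_{I_1(\bar x)}^Tb=0$. An M-stationary point $\bar x$ is called nondegenerate if both of the following hold: (ND1) if $\|\bar x\|_0<s$, then all entries of the vector $A_{I_0(\bar x)}^TA_{I_1(\bar x)}\bar x_{I_1(\bar x)}-A_{I_0(\bar x)}^Tb$ are non-zero;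 (ND2) $\mathrm{rank}(A_{I_1(\bar x)})=\|\bar x\|_0$. Fix an arbitrary norm $\|(A,b)\|$ on the data space $\mathbb{R}^{m\times n}\times\mathbb{R}^m$, and let $B(\bar x,\varepsilon)$ denote the ball in $\mathbb{R}^n$ with center $\bar x$ and radius $\varepsilon$. An M-stationary point $\bar x$ of $\mathrm{SR}(A,b)$ is called strongly stable if for some $r>0$ and each $\varepsilon\in(0,r]$ there exists $\delta>0$ such that whenever $(\widetilde A,\widetilde b)\in\mathbb{R}^{m\times n}\times\mathbb{R}^m$ satisfies $\|(\widetilde A,\widetilde b)-(A,b)\|\le\delta$, the ball $B(\bar x,\varepsilon)$ contains an M-stationary point $\widetilde x$ of $\mathrm{SR}(\widetilde A,\widetilde b)$ that is unique within the ball $B(\bar x,r)$ (i.e. it is the only M-stationary point of $\mathrm{SR}(\widetilde A,\widetilde b)$ in $B(\bar x,r)$). *)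

(* Defs.v *)
From mathcomp Require Import all_boot all_order all_algebra.
From mathcomp Require Import reals.

Set Implicit Arguments.
Unset Strict Implicit.
Unset Printing Implicit Defensive.

Import Order.TTheory GRing.Theory Num.Theory.
Local Open Scope ring_scope.

Record is_norm (R : realType) (V : lmodType R) (N : V -> R) : Prop := IsNorm {
  is_norm_triangle : forall u v, N (u + v) <= N u + N v;
  is_norm_scale : forall (a : R) u, N (a *: u) = `|a| * N u;
  is_norm_eq0 : forall u, N u = 0 -> u = 0 }.

(* The library's norm `|x| on column vectors is the max norm. *)
Definition l2norm (R : realType) (n : nat) (x : 'cV[R]_n) : R :=
  Num.sqrt (\sum_(i < n) x i 0 ^+ 2).

(* Closed Euclidean ball. *)
Definition in_ball (R : realType) (n : nat) (c : 'cV[R]_n) (e : R)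
  (x : 'cV[R]_n) : Prop := l2norm (x - c) <= e.

Definition I0 (R : realType) (n : nat) (x : 'cV[R]_n) : {set 'I_n} :=
  [set i | x i 0 == 0].

Definition I1 (R : realType) (n : nat) (x : 'cV[R]_n) : {set 'I_n} :=
  [set i | x i 0 != 0].

Definition l0norm (R : realType) (n : nat) (x : 'cV[R]_n) : nat :=
  #|[set i | x i 0 != 0]|.

Definition sparse (R : realType) (n s : nat) (x : 'cV[R]_n) : Prop :=
  (l0norm x <= s)%N.

(* A_I and x_I; enum_val enumerates the indices in I in increasing order. *)
Definition subcols (R : realType) (m n : nat) (A : 'M[R]_(m, n))
  (I : {set 'I_n}) : 'M[R]_(m, #|I|) :=
  colsub (fun k : 'I_#|I| => enum_val k) A.

Definition subvec (R : realType) (n : nat) (x : 'cV[R]_n)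
  (I : {set 'I_n}) : 'cV[R]_#|I| :=
  rowsub (fun k : 'I_#|I| => enum_val k) x.

Definition Mstationary (R : realType) (m n s : nat)
  (A : 'M[R]_(m, n)) (b : 'cV[R]_m) (x : 'cV[R]_n) : Prop :=
  sparse s x /\
  (subcols A (I1 x))^T *m subcols A (I1 x) *m subvec x (I1 x)
    - (subcols A (I1 x))^T *m b = 0.

Definition ND1 (R : realType) (m n s : nat)
  (A : 'M[R]_(m, n)) (b : 'cV[R]_m) (x : 'cV[R]_n) : Prop :=
  (l0norm x < s)%N ->
  forall k : 'I_#|I0 x|,
    ((subcols A (I0 x))^T *m subcols A (I1 x) *m subvec x (I1 x)
      - (subcols A (I0 x))^T *m b) k 0 != 0.

Definition ND2 (R : realType) (m n : nat)
  (A : 'M[R]_(m, n)) (x : 'cV[R]_n) : Prop :=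
  \rank (subcols A (I1 x)) = l0norm x.

Definition nondegenerate_Mstationary (R : realType) (m n s : nat)
  (A : 'M[R]_(m, n)) (b : 'cV[R]_m) (x : 'cV[R]_n) : Prop :=
  ND1 s A b x /\ ND2 A x.

Definition strongly_stable (R : realType) (m n s : nat)
  (N : 'M[R]_(m, n) * 'cV[R]_m -> R)
  (A : 'M[R]_(m, n)) (b : 'cV[R]_m) (x : 'cV[R]_n) : Prop :=
  exists2 r : R, 0 < r &
  forall e : R, 0 < e -> e <= r ->
  exists2 d : R, 0 < d &
  forall (A' : 'M[R]_(m, n)) (b' : 'cV[R]_m),
    N ((A', b') - (A, b)) <= d ->
    exists x' : 'cV[R]_n,
      [/\ in_ball x e x', Mstationary s A' b' x'
        & forall y : 'cV[R]_n,
            in_ball x r y -> Mstationary s A' b' y -> y = x'].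

(* Main.v *)
Require Import Defs.
From mathcomp Require Import all_boot all_order all_algebra.
From mathcomp Require Import reals lra.
From mathcomp Require Import boolp classical_sets filter topology normedtype.
From mathcomp Require Import derive realfun.

Set Implicit Arguments.
Unset Strict Implicit.
Unset Printing Implicit Defensive.

Import Order.TTheory GRing.Theory Num.Theory numFieldNormedType.Exports.
Local Open Scope classical_set_scope.
Local Open Scope ring_scope.

(** With the gradient [g = A^T (A y - b)] of the objective, a sparse [y] is
    M-stationary exactly when [g] vanishes on the support of [y].  Write [I] for
    the support of the given point [x].

    Sufficiency of nondegeneracy.  A point [y] close to [x] is nonzero on [I].
    If [I] has [s] elements, sparsity forces the support of [y] to be [I]; if it
    has fewer, ND1 says that [g] is nonzero off [I] at [x], hence at all nearby
    points and data, and stationarity again forces the support of [y] to be [I].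
    So the M-stationary points near [x] are the points with support [I] that
    solve the normal equations [A_I^T A_I y_I = A_I^T b].  By ND2 the Gram
    matrix is invertible, for nearby data as well; the system has one solution
    ([normal_solutionP]), which varies continuously with the data by Cramer's
    rule ([mxcvg_invmx]).  That closeness of
    the data in an arbitrary norm means closeness of all entries is the
    equivalence of norms in finite dimension ([is_norm_coord_le]).

    Necessity.  It is enough to move [b] along a line [b + t w] and to exhibit
    two distinct directions [y], [z] such that [x + t y] and [x + t z] are both
    M-stationary for every [t]: for small [t > 0] both lie in the ball where
    uniqueness is asserted ([strongly_stable_curves]).
    If ND2 fails, a nonzero [y] supported in [I] with [A y = 0] leaves the
    gradient unchanged, so [w = 0] and the directions [y] and [0] will do.
    If ND1 fails, [g] vanishes at some [i] outside [I] and one more index is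
    allowed in the support.  Take [w = A e_i].  Along [y = e_i] the residual,
    hence the gradient, keeps its value at [x], and it vanishes on [I] and at
    [i].  Along [z], the least-squares fit of [A e_i] by the columns in [I]
    (ND2 is already known), the gradient still vanishes on [I].  Since
    [z_i = 0], the two directions differ. *)

(** * Supported vectors, and stationarity through the gradient *)

Section SupportedVectors.
Variables (R : realType) (m n : nat).
Implicit Types (A : 'M[R]_(m, n)) (b : 'cV[R]_m) (x y : 'cV[R]_n).
Implicit Types (I : {set 'I_n}).

Definition supported x I : Prop := forall i, i \notin I -> x i 0 = 0.

Definition gradient A b x : 'cV[R]_n := A^T *m (A *m x - b).

(** Zero extension from [I] to all indices: the columns with index in [I] of the
    identity matrix are the inclusion of coordinates. *)
Definition extend I (u : 'cV[R]_#|I|) : 'cV[R]_n := subcols 1%:M I *m u.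

Lemma supported_I1 x : supported x (I1 x).
Proof. by move=> i; rewrite inE negbK => /eqP. Qed.

Lemma supported_sub x I : supported x I -> I1 x \subset I.
Proof.
move=> xI; apply/fintype.subsetP => i; rewrite inE; apply: contraR => iI.
by rewrite xI.
Qed.

Lemma supportedDZ x y I t :
  supported x I -> supported y I -> supported (x + t *: y) I.
Proof. by move=> xI yI i iI; rewrite !mxE xI// yI// mulr0 addr0. Qed.

Lemma subvec_tr_mul A I (w : 'cV[R]_m) :
  (subcols A I)^T *m w = subvec (A^T *m w) I.
Proof.
by apply/colP => k; rewrite !mxE; apply: eq_bigr => i _; rewrite !mxE.
Qed.

Lemma subcols_mul_subvec A x I :
  supported x I -> subcols A I *m subvec x I = A *m x.
Proof.
move=> xI; apply/colP => i; rewrite !mxE.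
rewrite (bigID (mem I)) /= [X in _ = _ + X]big1 ?addr0; last first.
  by move=> j jI; rewrite xI// mulr0.
by rewrite [RHS]big_enum_val; apply: eq_bigr => k _; rewrite !mxE.
Qed.

(** Every vector compared with zero in the definitions of M-stationarity and
    nondegeneracy is a restriction of the full gradient; this takes the
    dependence on the support of [x] out of the matrix dimensions. *)
Lemma subcols_gradient A b x I (K : {set 'I_n}) : supported x I ->
  (subcols A K)^T *m subcols A I *m subvec x I - (subcols A K)^T *m b
  = subvec (gradient A b x) K.
Proof.
by move=> xI; rewrite -mulmxA subcols_mul_subvec// -mulmxBr subvec_tr_mul.
Qed.

Lemma supported_extend I (u : 'cV[R]_#|I|) : supported (extend u) I.
Proof.
move=> i iI; rewrite !mxE big1// => k _; rewrite !mxE.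
by case: eqP => [ik|]; rewrite ?mul0r//; move: iI; rewrite ik enum_valP.
Qed.

Lemma mul_extend A I (u : 'cV[R]_#|I|) : A *m extend u = subcols A I *m u.
Proof.
rewrite /extend mulmxA; congr (_ *m _); apply/matrixP => i k.
rewrite !mxE (bigD1 (enum_val k)) //= !mxE eqxx mulr1 big1 ?addr0// => j jk.
by rewrite !mxE (negPf jk) mulr0.
Qed.

Lemma subvec_extend I (u : 'cV[R]_#|I|) : subvec (extend u) I = u.
Proof.
apply/colP => k; rewrite !mxE (bigD1 k) //= !mxE eqxx mul1r big1 ?addr0//.
by move=> j jk; rewrite !mxE (inj_eq enum_val_inj) eq_sym (negPf jk) mul0r.
Qed.

Lemma supported_inj x y I :
  supported x I -> supported y I -> subvec x I = subvec y I -> x = y.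
Proof.
move=> xI yI xy; apply/colP => i; have [iI|iI] := boolP (i \in I); last first.
  by rewrite xI// yI.
by have := congr1 (fun v : 'cV_#|I| => v (enum_rank_in iI i) 0) xy;
  rewrite !mxE enum_rankK_in.
Qed.

(** The support of [x] may be smaller than [I], so that along a line of points
    one index set serves for all parameters. *)
Lemma Mstationary_supported s A b x I : supported x I -> (#|I| <= s)%N ->
  subvec (gradient A b x) I = 0 -> Mstationary s A b x.
Proof.
move=> xI Is gI; split.
  exact: leq_trans (subset_leq_card (supported_sub xI)) Is.
rewrite (subcols_gradient _ _ _ (@supported_I1 x)); apply/colP => k.
rewrite !mxE; have kI : enum_val k \in I.
  exact: (fintype.subsetP (supported_sub xI)) (enum_valP k).
have := congr1 (fun v : 'cV_#|I| => v (enum_rank_in kI (enum_val k)) 0) gI.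
by rewrite !mxE enum_rankK_in.
Qed.

Lemma Mstationary_gradient s A b x :
  Mstationary s A b x -> subvec (gradient A b x) (I1 x) = 0.
Proof. by case=> _; rewrite (subcols_gradient _ _ _ (@supported_I1 x)). Qed.

Lemma Mstationary_gradient_eq0 s A b x i :
  Mstationary s A b x -> x i 0 != 0 -> gradient A b x i 0 = 0.
Proof.
move=> /Mstationary_gradient xS xi.
have iI : i \in I1 x by rewrite inE.
have := congr1 (fun v : 'cV_#|I1 x| => v (enum_rank_in iI i) 0) xS.
by rewrite !mxE enum_rankK_in.
Qed.

Lemma gradientD A b x t y w :
  gradient A (b + t *: w) (x + t *: y) =
  gradient A b x + t *: (A^T *m (A *m y - w)).
Proof.
rewrite /gradient scalemxAr -mulmxDr; congr (_ *m _).
by rewrite mulmxDr -scalemxAr scalerBr opprD addrACA.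
Qed.

End SupportedVectors.

(** * The normal equations *)

Section GramMatrix.
Variable (R : realType).

Lemma mulmx_tr_eq0 m (w : 'cV[R]_m) : w^T *m w = 0 -> w = 0.
Proof.
move=> w0; have := congr1 (fun v : 'M_1 => v 0 0) w0; rewrite !mxE => /eqP.
rewrite psumr_eq0; last by move=> i _; rewrite mxE -expr2 sqr_ge0.
move=> /allP w0'; apply/colP => i; have := w0' i (mem_index_enum i).
by rewrite !mxE mulf_eq0 orbb => /eqP.
Qed.

(** A column [v] with [B^T B v = 0] has [B v] of square norm
    [v^T B^T B v = 0], and [B] has independent columns. *)
Lemma gram_unitmx m k (B : 'M[R]_(m, k)) :
  \rank B = k -> B^T *m B \in unitmx.
Proof.
move=> rB; rewrite -row_free_unit; apply: inj_row_free => v vB.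
have : (B *m v^T)^T *m (B *m v^T) = 0.
  by rewrite trmx_mul trmxK mulmxA -(mulmxA v) vB mul0mx.
move/mulmx_tr_eq0 => Bv.
have rf : row_free B^T by rewrite /row_free mxrank_tr rB.
apply: (row_free_inj rf); apply: trmx_inj.
by rewrite trmx_mul trmxK Bv mul0mx trmx0.
Qed.

Lemma rank_defect m k (B : 'M[R]_(m, k)) :
  \rank B != k -> exists2 u : 'cV[R]_k, u != 0 & B *m u = 0.
Proof.
move=> rB; apply: contrapT => nex; move: rB; apply/negP; rewrite negbK.
rewrite -mxrank_tr; apply: inj_row_free => v vB.
have [//|v0] := eqVneq v 0; case: nex; exists v^T; first by rewrite trmx_eq0.
by apply: trmx_inj; rewrite trmx_mul trmxK vB trmx0.
Qed.

End GramMatrix.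

Section NormalSolution.
Variables (R : realType) (m n : nat).

(** For columns of full rank, the least-squares solution of [A' y = b'] among
    the vectors supported in [I], through the normal equations. *)
Definition normal_solution (I : {set 'I_n}) (A' : 'M[R]_(m, n))
    (b' : 'cV[R]_m) : 'cV[R]_n :=
  let B := subcols A' I in extend (invmx (B^T *m B) *m (B^T *m b')).

(** Restricted to vectors supported in [I], stationarity is a square linear
    system with the Gram matrix of the columns in [I]; where that matrix is
    invertible it leaves exactly one point, given by a formula continuous in
    the data. *)
Lemma normal_solutionP I A' b' y :
  (subcols A' I)^T *m subcols A' I \in unitmx -> supported y I ->
  subvec (gradient A' b' y) I = 0 <-> y = normal_solution I A' b'.
Proof.
move=> Bu yI; rewrite -(subcols_gradient _ _ _ yI); split.
  move/subr0_eq => yN; apply: (supported_inj yI); first exact: supported_extend.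
  by rewrite subvec_extend -yN mulKmx.
by move->; rewrite subvec_extend mulKVmx// subrr.
Qed.

End NormalSolution.

(** * Equivalence of norms in finite dimension *)

Section NormEquivalence.
Variable (R : realType).

Lemma is_norm0 (V : lmodType R) (N : V -> R) : is_norm N -> N 0 = 0.
Proof. by move=> hN; rewrite -(scale0r 0) is_norm_scale// normr0 mul0r. Qed.

Lemma is_norm_ge0 (V : lmodType R) (N : V -> R) v : is_norm N -> 0 <= N v.
Proof.
move=> hN; have := is_norm_triangle hN v (- v).
rewrite subrr is_norm0// -scaleN1r is_norm_scale// normrN1 mul1r.
by rewrite -mulr2n pmulrn_lge0.
Qed.

Lemma coord_le_mx_norm m n (M : 'M[R]_(m, n)) i j : `|M i j| <= `|M|.
Proof.
rewrite [leRHS]/Num.Def.normr /= mx_normrE.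
exact: (le_bigmax _ (fun ij => `|M ij.1 ij.2|) (i, j)).
Qed.

(** Decomposing along the canonical basis bounds [N] by a multiple of the max
    norm, so [N] is Lipschitz by the triangle inequality. *)
Lemma is_norm_continuous k (N : 'rV[R]_k -> R) : is_norm N -> continuous N.
Proof.
move=> hN.
pose K := \sum_(i < k) N (delta_mx 0 i).
have NK u : N u <= K * `|u|.
  rewrite {1}[u]row_sum_delta mulr_suml.
  elim/big_ind2 : _ => [|a b c d ab cd|i _]; first by rewrite is_norm0.
    exact: le_trans (is_norm_triangle hN _ _) (lerD ab cd).
  rewrite is_norm_scale// mulrC ler_wpM2l ?is_norm_ge0//.
  exact: coord_le_mx_norm.
have N_lip u v : N u - N v <= K * `|u - v|.
  rewrite lerBlDr; apply: le_trans (lerD (NK _) (lexx _)).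
  by rewrite -{1}(subrK v u) is_norm_triangle.
move=> u; apply: (cvgrPdist_le (FF := nbhs_filter u) _ _).2 => e e0 /=.
have K0 : 0 <= K by apply: sumr_ge0 => i _; exact: is_norm_ge0.
near=> v.
have uv : K * `|u - v| <= e.
  (* [K + 1] rather than [K] because [K] may be zero. *)
  rewrite (@le_trans _ _ ((K + 1) * `|u - v|))// ?ler_wpM2r ?lerDl//.
  rewrite mulrC -ler_pdivlMr ?ltr_wpDl//; near: v.
  by apply: cvgr_dist_le => //; rewrite divr_gt0// ltr_wpDl.
rewrite ler_norml lerNl opprB; apply/andP; split.
  by apply: le_trans (N_lip _ _) _; rewrite distrC.
exact: le_trans (N_lip _ _) _.
Unshelve. all: by end_near. Qed.

(** On the compact unit sphere of the max norm, [N] has a minimum, which is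
    positive since [N] vanishes only at zero; homogeneity does the rest. *)
Lemma is_norm_ge_mx_norm k (N : 'rV[R]_k -> R) : is_norm N ->
  exists2 C, 0 < C & forall u, `|u| <= C * N u.
Proof.
move=> hN; pose S := [set u : 'rV[R]_k | `|u| = 1].
have scaled u : u != 0 -> S (`|u|^-1 *: u).
  move=> u0; rewrite /S /= normrZ normrV ?unitfE ?normr_eq0// normr_id.
  by rewrite mulVf ?normr_eq0.
have [S0|S0] := pselect (S !=set0); last first.
  (* The sphere is empty only in dimension zero. *)
  exists 1 => // u; have [->|u0] := eqVneq u 0.
    by rewrite normr0 mul1r is_norm_ge0.
  by case: S0; exists (`|u|^-1 *: u); exact: scaled.
have cS : compact S.
  apply: bounded_closed_compact.
    by exists 1; split => // M M1 u /= ->; exact: ltW.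
  by apply: (closed_comp _ (@closed_eq _ 1)) => u _; exact: norm_continuous.
have [c] := EVT_min_rV S0 cS (continuous_subspaceT (is_norm_continuous hN)).
rewrite inE /S /= => c1 cmin.
have Nc : 0 < N c.
  rewrite lt_neqAle is_norm_ge0// andbT eq_sym.
  apply/eqP => /(is_norm_eq0 hN) c0.
  by move: c1; rewrite c0 normr0 => /eqP; rewrite eq_sym oner_eq0.
exists (N c)^-1; first by rewrite invr_gt0.
move=> u; have [->|u0] := eqVneq u 0.
  by rewrite normr0 mulr_ge0 ?invr_ge0 ?is_norm_ge0.
have := cmin (`|u|^-1 *: u); rewrite inE => /(_ (scaled _ u0)).
rewrite is_norm_scale// normrV ?unitfE ?normr_eq0// normr_id.
by rewrite ler_pdivlMl ?normr_gt0// mulrC ler_pdivlMl.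
Qed.

Lemma is_norm_coord_le m n (N : 'M[R]_(m, n) * 'cV[R]_m -> R) : is_norm N ->
  exists2 C, 0 < C & forall p : 'M[R]_(m, n) * 'cV[R]_m,
    (forall i j, `|p.1 i j| <= C * N p) /\ (forall i, `|p.2 i 0| <= C * N p).
Proof.
move=> hN.
pose phi (u : 'rV[R]_(m * n + m)) := (vec_mx (lsubmx u), (rsubmx u)^T).
have hphi : is_norm (N \o phi).
  split => [u v|a u|u] /=.
  - have -> : phi (u + v) = phi u + phi v by rewrite /phi !linearD.
    exact: is_norm_triangle.
  - have -> : phi (a *: u) = a *: phi u by rewrite /phi !linearZ.
    exact: is_norm_scale.
  - move=> /(is_norm_eq0 hN)[/eqP]; rewrite vec_mx_eq0 => /eqP ul.
    move=> /eqP; rewrite trmx_eq0 => /eqP ur.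
    by rewrite -[u]hsubmxK ul ur row_mx0.
have [C C0 hC] := is_norm_ge_mx_norm hphi; exists C => // p.
have pE : phi (row_mx (mxvec p.1) p.2^T) = p.
  by rewrite /phi row_mxKl row_mxKr mxvecK trmxK; case: (p).
have := hC (row_mx (mxvec p.1) p.2^T); rewrite /= pE => Np.
split=> [i j|i]; apply: le_trans Np.
  rewrite -(mxvecE p.1) -(row_mxEl (mxvec p.1) p.2^T); exact: coord_le_mx_norm.
have -> : p.2 i 0 = p.2^T 0 i by rewrite mxE.
rewrite -(row_mxEr (mxvec p.1) p.2^T); exact: coord_le_mx_norm.
Qed.

End NormEquivalence.

(** * The Euclidean norm *)

Section EuclideanNorm.
Variables (R : realType) (n : nat).
Implicit Types x y : 'cV[R]_n.

Lemma l2normZ (t : R) x : l2norm (t *: x) = `|t| * l2norm x.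
Proof.
rewrite /l2norm -sqrtr_sqr -sqrtrM ?sqr_ge0// mulr_sumr.
by congr Num.sqrt; apply: eq_bigr => i _; rewrite mxE exprMn.
Qed.

Lemma l2norm0 : l2norm (0 : 'cV[R]_n) = 0.
Proof. by rewrite -(scale0r 0) l2normZ normr0 mul0r. Qed.

Lemma coord_le_l2norm x i : `|x i 0| <= l2norm x.
Proof.
rewrite -sqrtr_sqr ler_wsqrtr// (bigD1 i)//= lerDl.
by apply: sumr_ge0 => j _; exact: sqr_ge0.
Qed.

Lemma l2norm_ge0 x : 0 <= l2norm x. Proof. exact: sqrtr_ge0. Qed.

End EuclideanNorm.

(** * Entrywise convergence of matrices along a filter *)

Section EntrywiseConvergence.
Variables (R : realType) (T : Type) (F : set_system T).
Context {FF : Filter F}.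

Definition mxcvg m n (f : T -> 'M[R]_(m, n)) (M : 'M[R]_(m, n)) : Prop :=
  forall i j, f t i j @[t --> F] --> (M i j : R^o).

Lemma cvg_sumR I (r : seq I) (P : pred I) (f : I -> T -> R) (l : I -> R) :
  (forall i, P i -> f i t @[t --> F] --> (l i : R^o)) ->
  \sum_(i <- r | P i) f i t @[t --> F] --> (\sum_(i <- r | P i) l i : R^o).
Proof. by move=> fl; apply: cvg_big => //; exact: add_continuous. Qed.

Lemma cvg_prodR I (r : seq I) (P : pred I) (f : I -> T -> R) (l : I -> R) :
  (forall i, P i -> f i t @[t --> F] --> (l i : R^o)) ->
  \prod_(i <- r | P i) f i t @[t --> F] --> (\prod_(i <- r | P i) l i : R^o).
Proof. by move=> fl; apply: cvg_big => //; exact: mul_continuous. Qed.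

Lemma mxcvg_cst m n (M : 'M[R]_(m, n)) : mxcvg (fun=> M) M.
Proof. by move=> i j; exact: cvg_cst. Qed.

Lemma mxcvgB m n (f g : T -> 'M[R]_(m, n)) M M' :
  mxcvg f M -> mxcvg g M' -> mxcvg (fun t => f t - g t) (M - M').
Proof.
move=> fM gM i j; rewrite !mxE; under eq_fun do rewrite !mxE.
exact: cvgB.
Qed.

Lemma mxcvg_tr m n (f : T -> 'M[R]_(m, n)) M :
  mxcvg f M -> mxcvg (fun t => (f t)^T) M^T.
Proof.
by move=> fM i j; rewrite mxE; under eq_fun do rewrite mxE; exact: fM.
Qed.

Lemma mxcvg_subcols m n (I : {set 'I_n}) (f : T -> 'M[R]_(m, n)) M :
  mxcvg f M -> mxcvg (fun t => subcols (f t) I) (subcols M I).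
Proof.
by move=> fM i j; rewrite mxE; under eq_fun do rewrite mxE; exact: fM.
Qed.

Lemma mxcvgM m n p (f : T -> 'M[R]_(m, n)) (g : T -> 'M[R]_(n, p)) M M' :
  mxcvg f M -> mxcvg g M' -> mxcvg (fun t => f t *m g t) (M *m M').
Proof.
move=> fM gM i j; rewrite !mxE; under eq_fun do rewrite !mxE.
by apply: cvg_sumR => k _; exact: cvgM.
Qed.

Lemma cvg_det n (f : T -> 'M[R]_n) M :
  mxcvg f M -> \det (f t) @[t --> F] --> (\det M : R^o).
Proof.
move=> fM; apply: cvg_sumR => s _; apply: cvgM; first exact: cvg_cst.
by apply: cvg_prodR => i _; exact: fM.
Qed.

Lemma mxcvg_unitmx n (f : T -> 'M[R]_n) M :
  mxcvg f M -> M \in unitmx -> \forall t \near F, f t \in unitmx.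
Proof.
rewrite unitmxE unitfE => /cvg_det fM /(cvgr_neq0 _ fM).
by apply: filterS => t; rewrite unitmxE unitfE.
Qed.

(** Cramer: the inverse is the adjugate divided by the determinant, wherever
    the latter is nonzero, which is eventually the case. *)
Lemma mxcvg_invmx n (f : T -> 'M[R]_n) M :
  mxcvg f M -> M \in unitmx -> mxcvg (fun t => invmx (f t)) (invmx M).
Proof.
move=> fM Mu i j.
have fu := mxcvg_unitmx fM Mu.
apply: (@cvg_trans _ (((\det (f t))^-1 * \adj (f t) i j) @[t --> F])).
  by apply: near_eq_cvg; apply: filterS fu => t ft; rewrite /invmx ft !mxE.
rewrite /invmx Mu mxE; apply: cvgM.
  by apply: cvgV; [rewrite -unitfE -unitmxE|exact: cvg_det].
rewrite mxE; under eq_fun do rewrite mxE.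
apply: cvgM; first exact: cvg_cst.
by apply: cvg_det => k l; rewrite !mxE; under eq_fun do rewrite !mxE; exact: fM.
Qed.

Lemma mxcvg_l2norm n (f : T -> 'cV[R]_n) x : mxcvg f x ->
  forall e, 0 < e -> \forall t \near F, l2norm (f t - x) <= e.
Proof.
move=> fx e e0.
have : l2norm (f t - x) @[t --> F] --> (0 : R^o).
  rewrite -(l2norm0 R n) -(subrr x).
  apply: (@continuous_cvg _ R^o R^o F _
    (fun t => \sum_(i < n) (f t - x) i 0 ^+ 2) Num.sqrt).
    exact: sqrt_continuous.
  apply: cvg_sumR => i _; rewrite !mxE; under eq_fun do rewrite !mxE.
  under eq_fun do rewrite expr2.
  by rewrite expr2; apply: cvgM; (apply: cvgB; [exact: fx|exact: cvg_cst]).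
move=> /cvgr_le; exact.
Qed.

End EntrywiseConvergence.

(** * Strong stability *)

Section Stability.
Variables (R : realType) (m n s : nat).
Variables (N : 'M[R]_(m, n) * 'cV[R]_m -> R) (hN : is_norm N).
Variables (A : 'M[R]_(m, n)) (b : 'cV[R]_m) (x : 'cV[R]_n).

(** Data close to [(A, b)] together with a point close to [x].  Data and point
    vary jointly because the radius of uniqueness must come with a
    neighbourhood of the data on which it works.  One [d] bounds both
    distances, and non-strictly, to match the balls of strong stability. *)
Definition near_data_point : set_system ('M[R]_(m, n) * 'cV[R]_m * 'cV[R]_n) :=
  [set P | exists2 d, 0 < d & forall A' b' y,
    N ((A', b') - (A, b)) <= d -> l2norm (y - x) <= d -> P (A', b', y)].

Local Instance near_data_point_filter : Filter near_data_point.
Proof.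
split.
- by exists 1.
- move=> P Q [d d0 hP] [e e0 hQ]; exists (Num.min d e).
    by rewrite lt_min d0 e0.
  move=> A' b' y; rewrite !le_min => /andP[Ad Ae] /andP[yd ye].
  by split; [exact: hP|exact: hQ].
- move=> P Q PQ [d d0 hP]; exists d => // A' b' y Ad yd.
  by apply: PQ; exact: hP.
Qed.

Lemma cvg_near_data_point (f : 'M[R]_(m, n) * 'cV[R]_m * 'cV[R]_n -> R) l C :
  0 < C ->
  (forall A' b' y, `|f (A', b', y) - l| <= C * N ((A', b') - (A, b)) \/
    `|f (A', b', y) - l| <= C * l2norm (y - x)) ->
  f t @[t --> near_data_point] --> (l : R^o).
Proof.
move=> C0 fl.
apply: (cvgrPdist_le (FF := near_data_point_filter) _ _).2 => e e0.
exists (e / C); first by rewrite divr_gt0.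
move=> A' b' y Ad yd; rewrite /= distrC.
case: (fl A' b' y) => /le_trans; apply; rewrite mulrC -ler_pdivlMr//.
Qed.

Lemma mxcvg_data :
  mxcvg near_data_point (fun t => t.1.1) A /\
  mxcvg near_data_point (fun t => t.1.2) b.
Proof.
have [C C0 hC] := is_norm_coord_le hN.
split=> i j; apply: (cvg_near_data_point C0) => A' b' y; left;
  have [hA hb] := hC ((A', b') - (A, b)).
  by have := hA i j; rewrite /= !mxE.
by have := hb i; rewrite /= !mxE ord1.
Qed.

Lemma mxcvg_point : mxcvg near_data_point (fun t => t.2) x.
Proof.
move=> i j; apply: (cvg_near_data_point ltr01) => A' b' y; right.
by have := coord_le_l2norm (y - x) i; rewrite !mxE mul1r ord1.
Qed.

Hypothesis hx : Mstationary s A b x.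

(** Near [x], every M-stationary point for nearby data has the support of [x]
    and is therefore the solution of the normal equations there. *)
Lemma nondegenerate_strongly_stable :
  nondegenerate_Mstationary s A b x -> strongly_stable s N A b x.
Proof.
move=> [nd1 nd2]; set I := I1 x in nd2 *.
have [cA cb] := mxcvg_data; have cy := mxcvg_point.
have Bu := gram_unitmx nd2.
have cB := mxcvg_subcols (I := I) cA.
have cG : mxcvg near_data_point
    (fun t => (subcols t.1.1 I)^T *m subcols t.1.1 I)
    ((subcols A I)^T *m subcols A I).
  by apply: mxcvgM (cB); apply: mxcvg_tr.
have cgrad : mxcvg near_data_point
    (fun t => gradient t.1.1 t.1.2 t.2) (gradient A b x).
  apply: mxcvgM; first exact: mxcvg_tr.
  by apply: mxcvgB cb; exact: mxcvgM.
have csol : mxcvg near_data_point (fun t => normal_solution I t.1.1 t.1.2) x.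
  have -> : x = normal_solution I A b.
    apply/(normal_solutionP _ Bu (@supported_I1 _ _ x)).
    exact: Mstationary_gradient hx.
  apply: mxcvgM; first exact: mxcvg_cst.
  apply: mxcvgM; first exact: mxcvg_invmx cG Bu.
  exact: mxcvgM (mxcvg_tr cB) cb.
have nz : \forall t \near near_data_point, forall i : 'I_n,
    i \in I -> (t.2 : 'cV[R]_n) i 0 != 0.
  apply: (@filter_forall _ _
    (fun i t => i \in I -> (t.2 : 'cV[R]_n) i 0 != 0) near_data_point _) => i.
  have [iI|_] := boolP (i \in I).
    rewrite inE in iI.
    by apply: filterS (cvgr_neq0 _ (cy i 0) iI) => t.
  by apply: filterS filterT => t.
have ngrad : \forall t \near near_data_point, forall i : 'I_n,
    (#|I| < s)%N -> i \notin I -> gradient t.1.1 t.1.2 t.2 i 0 != 0.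
  apply: (@filter_forall _ _
    (fun i t => (#|I| < s)%N -> i \notin I ->
      gradient t.1.1 t.1.2 t.2 i 0 != 0) near_data_point _) => i.
  have [Is|_] := boolP (#|I| < s)%N; last first.
    by apply: filterS filterT => t.
  have [_|iI] := boolP (i \in I); first by apply: filterS filterT => t.
  have iI0 : i \in I0 x by move: iI; rewrite !inE negbK.
  have := nd1 Is (enum_rank_in iI0 i).
  rewrite (subcols_gradient _ _ _ (@supported_I1 _ _ x)) mxE enum_rankK_in//.
  move/(cvgr_neq0 _ (cgrad i 0)) => ci.
  by apply: filterS ci => t.
(* [r] controls the data and the candidate points at once, before any [e]. *)
have [r r0 hr] := filterI (mxcvg_unitmx cG Bu) (filterI nz ngrad).
exists r => // e e0 er.
have [d d0 hd] := mxcvg_l2norm csol e0.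
exists (Num.min r d); first by rewrite lt_min r0 d0.
move=> A' b'; rewrite le_min => /andP[Ar Ad].
have near_r y : l2norm (y - x) <= r -> _ := hr A' b' y Ar.
have solE : l2norm (normal_solution I A' b' - x) <= e.
  by apply: (hd A' b' x Ad); rewrite subrr l2norm0 ltW.
have [B'u _] := near_r _ (le_trans solE er).
have sI : supported (normal_solution I A' b') I by exact: supported_extend.
exists (normal_solution I A' b'); split => //.
  by apply: (Mstationary_supported sI); [exact: hx.1|apply/normal_solutionP].
move=> y yr yS; have [_ [/= ynz yng]] := near_r _ yr.
have Iy : I \subset I1 y by apply/fintype.subsetP => i /ynz; rewrite inE.
(* Either sparsity or the nonzero gradient off [I] excludes a larger support. *)
have IyE : I = I1 y.
  apply/eqP; rewrite eqEcard Iy /=.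
  have [Is|] := ltnP #|I| s; last exact: leq_trans yS.1.
  apply/subset_leq_card/fintype.subsetP => i; rewrite inE => yi.
  apply: contraT => iI; have := yng i Is iI.
  by rewrite (Mstationary_gradient_eq0 yS yi) eqxx.
apply/normal_solutionP => //; rewrite IyE; first exact: supported_I1.
exact: Mstationary_gradient yS.
Qed.

(** For a small [t > 0] both points lie in the ball where strong stability
    allows a single M-stationary point, so they coincide. *)
Lemma strongly_stable_curves (y z : 'cV[R]_n) (w : 'cV[R]_m) :
  strongly_stable s N A b x ->
  (forall t, Mstationary s A (b + t *: w) (x + t *: y)) ->
  (forall t, Mstationary s A (b + t *: w) (x + t *: z)) ->
  y = z.
Proof.
move=> [r r0 /(_ r r0 (lexx r))[d d0 hd]] yS zS.
pose K := N (0, w) + l2norm y + l2norm z + 1.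
have Nw := is_norm_ge0 (0, w) hN.
have [ly lz] : 0 <= l2norm y /\ 0 <= l2norm z by split; exact: l2norm_ge0.
have K0 : 0 < K by rewrite ltr_wpDl// !addr_ge0.
(* [t] times any of the three norms is at most [Num.min r d]. *)
pose t := Num.min r d / K.
have t0 : 0 < t by rewrite divr_gt0// lt_min r0 d0.
have tK a : a <= K -> `|t| * a <= Num.min r d.
  move=> aK; rewrite gtr0_norm// /t mulrAC ler_pdivrMr// ler_wpM2l//.
  by rewrite le_min !ltW.
have in_r v : l2norm v <= K -> in_ball x r (x + t *: v).
  move=> /tK; rewrite le_min => /andP[vr _].
  by rewrite /in_ball addrC addKr l2normZ.
have := hd A (b + t *: w).
have -> : (A, b + t *: w) - (A, b) = t *: ((0, w) : 'M[R]_(m, n) * 'cV[R]_m).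
  by congr pair; rewrite /= ?subrr ?scaler0// addrC addKr.
rewrite is_norm_scale// => /(_ _)[].
  have /tK : N (0, w) <= K by rewrite /K; lra.
  by rewrite le_min => /andP[].
move=> x' [_ _ uniq].
have yx' : x + t *: y = x' by apply: uniq => //; apply: in_r; rewrite /K; lra.
have zx' : x + t *: z = x' by apply: uniq => //; apply: in_r; rewrite /K; lra.
have /addrI/eqP := etrans yx' (esym zx').
by rewrite -subr_eq0 -scalerBr scaler_eq0 gt_eqF//= subr_eq0 => /eqP.
Qed.

(** A nonzero kernel vector of [A] supported in the support of [x] gives a line
    of M-stationary points through [x] for unchanged data. *)
Lemma strongly_stable_ND2 : strongly_stable s N A b x -> ND2 A x.
Proof.
move=> st; apply/eqP; apply: contraT => /rank_defect[u u0 Bu0].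
suff ue : extend u = 0.
  by rewrite -(subvec_extend u) ue /subvec in u0; move: u0; rewrite raddf0 eqxx.
have x0S (t : R) z : supported z (I1 x) -> A *m z = 0 ->
    Mstationary s A (b + t *: 0) (x + t *: z).
  move=> zI Az; apply: (@Mstationary_supported _ _ _ _ _ _ _ (I1 x)).
  - by apply: supportedDZ => //; exact: supported_I1.
  - exact: hx.1.
  rewrite gradientD Az subrr mulmx0 scaler0 addr0.
  exact: Mstationary_gradient hx.
apply: (strongly_stable_curves (w := 0) st) => t; apply: x0S.
- exact: supported_extend.
- by rewrite mul_extend.
- by move=> i _; rewrite mxE.
- by rewrite mulmx0.
Qed.

(** Shifting [b] by [t A e_i] can be compensated by [t e_i], which uses the
    index [i] with vanishing gradient, or by a least-squares fit inside the
    support of [x]: the point bifurcates. *)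
Lemma strongly_stable_ND1 : strongly_stable s N A b x -> ND1 s A b x.
Proof.
move=> st Is k; rewrite (subcols_gradient _ _ _ (@supported_I1 _ _ x)) mxE.
set i := enum_val k; have iI : i \notin I1 x.
  by have := enum_valP k; rewrite !inE negbK.
apply/negP => /eqP gi.
have Bu := gram_unitmx (strongly_stable_ND2 st).
pose e : 'cV[R]_n := delta_mx i 0; pose w := A *m e.
pose z := normal_solution (I1 x) A w.
have zI : supported z (I1 x) by exact: supported_extend.
suff : e = z.
  move/(congr1 (fun v : 'cV_n => v i 0)); rewrite zI// mxE !eqxx => /eqP.
  by rewrite oner_eq0.
have xg := Mstationary_gradient hx.
apply: (strongly_stable_curves (w := w) st) => t.
  (* Along [e_i] the support may grow to [i |: I1 x], of at most [s] elements,
     and the gradient is that of [x]. *)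
  apply: (@Mstationary_supported _ _ _ _ _ _ _ (i |: I1 x)).
  - apply: supportedDZ => j; rewrite !inE negb_or => /andP[ji].
      by rewrite negbK => /eqP.
    by move=> _; rewrite mxE (negPf ji).
  - by rewrite cardsU1 iI.
  rewrite gradientD subrr mulmx0 scaler0 addr0; apply/colP => l.
  rewrite [LHS]mxE [RHS]mxE.
  have := enum_valP l; rewrite !inE => /orP[/eqP->//|xl].
  exact: Mstationary_gradient_eq0 hx xl.
(* Along [z] the support stays in [I1 x], where the normal equations cancel
   the change of the gradient. *)
apply: (@Mstationary_supported _ _ _ _ _ _ _ (I1 x)).
- by apply: supportedDZ => //; exact: supported_I1.
- exact: hx.1.
have zg : subvec (gradient A w z) (I1 x) = 0 by apply/normal_solutionP.
by rewrite gradientD /subvec linearD linearZ /= -!/(subvec _ _) xg zg scaler0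
  addr0.
Qed.

End Stability.

Theorem theorem3 (R : realType) (m n s : nat) (hsn : (s < n)%N) (hsm : (s <= m)%N)
  (N : 'M[R]_(m, n) * 'cV[R]_m -> R) (hN : is_norm N)
  (A : 'M[R]_(m, n)) (b : 'cV[R]_m) (x : 'cV[R]_n)
  (hx : Mstationary s A b x) :
  strongly_stable s N A b x <-> nondegenerate_Mstationary s A b x.
Proof.
split; last exact: nondegenerate_strongly_stable.
move=> st; split.
  exact: strongly_stable_ND1 st.
exact: strongly_stable_ND2 st.
Qed.
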